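(* Let $\eta,\vartheta\in\{p,bp,r\}$. For $a=(a_{mn})\in\Omega$ define the four-dimensional matrix $B=B(a)=(b_{mnij})$ by $$b_{mnij}=\begin{cases}\displaystyle\sum_{p=i}^{m}\sum_{q=j}^{n}a_{pq}, & 0\le i\le m,\ 0\le j\le n,\\[1ex] 0, & \text{otherwise}.\end{cases}$$ Then $$\{\mathcal{C}_\eta(\Delta)\}^{\beta(\vartheta)}=\big\{a=(a_{mn})\in\Omega:\ B(a)\in(\mathcal{C}_\eta:\mathcal{C}_\vartheta)\big\}.$$
   Context: $\Omega$ is the vector space of all real double sequences $x=(x_{mn})_{m,n\ge 0}$. Terms with a negative index are taken to be $0$. The difference transform of $x\in\Omega$ is $\Delta x=((\Delta x)_{mn})$ with $(\Delta x)_{mn}=x_{mn}-x_{m,n-1}-x_{m-1,n}+x_{m-1,n-1}$. A double sequence $x$ converges in Pringsheim's sense to $l$ ($p\text{-}\lim x_{mn}=l$) if for every $\varepsilon>0$ there is $n_0$ with $|x_{mn}-l|<\varepsilon$ for all $m,n>n_0$. $\mathcal{C}_p$: double sequences convergent in Pringsheim's sense; $\mathcal{C}_{bp}$: those in $\mathcal{C}_p$ that are bounded; $\mathcal{C}_r$ (regularly convergent): those $x\in\mathcal{C}_p$ such that $(x_{mn})_n$ converges for every $m$ and $(x_{mn})_m$ converges for every $n$. For $v\in\{p,bp,r\}$, $v\text{-}\lim x_{mn}$ exists iff $x\in\mathcal{C}_v$, and is then the Pringsheim limit. $\mathcal{C}_\eta(\Delta)=\{x\in\Omega:\Delta x\in\mathcal{C}_\eta\}$.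 The $\beta(\vartheta)$-dual of $\lambda\subset\Omega$ is $\lambda^{\beta(\vartheta)}=\{(a_{ij})\in\Omega:\vartheta\text{-}\lim_{m,n\to\infty}\sum_{i=0}^m\sum_{j=0}^n a_{ij}x_{ij}\text{ exists for all }(x_{ij})\in\lambda\}$. For a four-dimensional matrix $B=(b_{mnij})$ and $y\in\Omega$, $By$ has entries $(By)_{mn}=\sum_{i,j}b_{mnij}y_{ij}$ (finite sums for the matrix $B(a)$ above), and $B\in(\lambda:\mu)$ means that $By$ exists and belongs to $\mu$ for every $y\in\lambda$. *)

(* Defs.v *)
From HB Require Import structures.
From mathcomp Require Import all_boot all_order all_algebra.
From mathcomp Require Import classical_sets boolp reals topology normedtype sequences.

Set Implicit Arguments.
Unset Strict Implicit.
Unset Printing Implicit Defensive.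

Import Order.TTheory GRing.Theory Num.Theory.
Import numFieldNormedType.Exports.

Local Open Scope classical_set_scope.
Local Open Scope ring_scope.

Definition dseq (R : realType) : Type := nat -> nat -> R.

(* Image of the product filter \oo x \oo: both indices tend to infinity
   independently; see [pringsheimP] for the epsilon form. *)
Definition pringsheim (R : realType) (x : dseq R) : set_system R :=
  x mn.1 mn.2 @[mn --> (\oo, \oo)].

Lemma pringsheimP (R : realType) (x : dseq R) (l : R) :
  pringsheim x --> l <->
  (forall e : R, 0 < e -> exists n0 : nat, forall m n : nat,
     (n0 < m)%N -> (n0 < n)%N -> `|x m n - l| < e).
Proof.
split=> [/cvgrPdist_lt xl e e0|xl].
  have [[A B] /= [[a _ aA] [b _ bB]] AB] := xl e e0.
  exists (maxn a b) => m n; rewrite !gtn_max => /andP[am _] /andP[_ bn].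
  rewrite distrC; apply: (AB (m, n)); split => /=.
    by apply: aA => /=; exact: ltnW.
  by apply: bB => /=; exact: ltnW.
apply/cvgrPdist_lt => e /xl[n0 H].
exists ([set m | (n0 < m)%N], [set n | (n0 < n)%N]) => /=.
  by split; exists n0.+1.
by move=> [m n] /= [m0 n0n]; rewrite distrC; exact: H.
Qed.

Definition space_p (R : realType) : set (dseq R) :=
  [set x | exists l : R, pringsheim x --> l].

Definition space_bp (R : realType) : set (dseq R) :=
  [set x | space_p x /\ exists M : R, forall m n, `|x m n| <= M].

Definition space_r (R : realType) : set (dseq R) :=
  [set x | [/\ space_p x,
               forall m, cvgn (fun n => x m n) &
               forall n, cvgn (fun m => x m n)]].

Inductive conv_mode := mode_p | mode_bp | mode_r.

(* The v-limit of x exists iff [conv_space v x]. *)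
Definition conv_space (R : realType) (v : conv_mode) : set (dseq R) :=
  match v with
  | mode_p => @space_p R
  | mode_bp => @space_bp R
  | mode_r => @space_r R
  end.
Arguments conv_space : clear implicits.

Definition ddelta (R : realType) (x : dseq R) : dseq R := fun m n =>
  x m n
  - (if n is n'.+1 then x m n' else 0)
  - (if m is m'.+1 then x m' n else 0)
  + (match m, n with m'.+1, n'.+1 => x m' n' | _, _ => 0 end).

Definition delta_domain (R : realType) (L : set (dseq R)) : set (dseq R) :=
  [set x | L (ddelta x)].

Definition dpartial_sum (R : realType) (x : dseq R) : dseq R := fun m n =>
  \sum_(0 <= i < m.+1) \sum_(0 <= j < n.+1) x i j.

Definition beta_dual (R : realType) (v : conv_mode) (L : set (dseq R)) :
    set (dseq R) :=
  [set a | forall x, L x ->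
     conv_space R v (dpartial_sum (fun i j => a i j * x i j))].

Definition matrix4 (R : realType) : Type := nat -> nat -> dseq R.

(* The double series defining an entry of the transform is summed in
   Pringsheim's sense; for a matrix whose (m,n)-section vanishes outside
   i <= m, j <= n it is the finite sum. *)
Definition transform_exists (R : realType) (B : matrix4 R) (y : dseq R) : Prop :=
  forall m n, space_p (dpartial_sum (fun i j => B m n i j * y i j)).

Definition transform (R : realType) (B : matrix4 R) (y : dseq R) : dseq R :=
  fun m n => lim (pringsheim (dpartial_sum (fun i j => B m n i j * y i j))).

Definition matrix_class (R : realType) (L M : set (dseq R)) : set (matrix4 R) :=
  [set B | forall y, L y -> transform_exists B y /\ M (transform B y)].

Definition dual_matrix (R : realType) (a : dseq R) : matrix4 R :=
  fun m n i j =>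
    if (i <= m)%N && (j <= n)%N
    then \sum_(i <= p < m.+1) \sum_(j <= q < n.+1) a p q
    else 0.

(* Main.v *)
Require Import Defs.
From mathcomp Require Import all_boot all_order all_algebra.
From mathcomp Require Import classical_sets boolp reals topology normedtype sequences.

(** The difference transform [ddelta] and the rectangular partial sum
    [dpartial_sum] are mutually inverse bijections of the space of all double
    sequences ([ddeltaK], [dpartial_sumK]), so [delta_domain L] consists
    exactly of the partial sums [x = dpartial_sum y] with [y] in [L].

    For such an [x], two-dimensional summation by parts ([abel_dpartial_sum])
    gives, with [B = dual_matrix a],

      sum_(i <= m, j <= n) a_ij x_ij = sum_(k <= m, l <= n) b_mnkl y_kl,

    obtained by expanding [x_ij] as a sum over [k <= i], [l <= j] and
    exchanging the order of summation.  Since the (m, n)-section of [B] is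
    supported on that rectangle, the right-hand side is the full double series
    defining the (m, n) entry of [transform B y] ([dual_matrix_cvg]), and this
    series always converges.  Hence the sequence tested in the dual and the one
    tested in the matrix class are the same double sequence
    ([transform_dual_matrix]), whatever the two modes of convergence. *)

Import GRing.Theory Num.Theory.
Import numFieldNormedType.Exports.

Local Open Scope classical_set_scope.
Local Open Scope ring_scope.

Section Differences.
Context {V : zmodType}.
Implicit Types f : nat -> V.

Definition backward_diff f (n : nat) : V :=
  f n - (if n is n'.+1 then f n' else 0).

Lemma sum_backward_diff f n :
  \sum_(0 <= j < n.+1) backward_diff f j = f n.
Proof.
elim: n => [|n IHn]; first by rewrite big_nat1 /backward_diff subr0.
by rewrite big_nat_recr //= IHn /backward_diff addrC subrK.
Qed.

Lemma backward_diff_sum f n :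
  backward_diff (fun m => \sum_(0 <= j < m.+1) f j) n = f n.
Proof.
case: n => [|n]; first by rewrite /backward_diff big_nat1 subr0.
by rewrite /backward_diff big_nat_recr //= [LHS]addrC addKr.
Qed.

Lemma exchange_triangular_sum (F : nat -> nat -> V) n :
  \sum_(0 <= i < n) \sum_(0 <= k < i.+1) F i k =
  \sum_(0 <= k < n) \sum_(k <= i < n) F i k.
Proof.
elim: n => [|n IHn]; first by rewrite !big_geq.
rewrite big_nat_recr //= IHn [RHS]big_nat_recr //= big_nat1.
rewrite big_nat_recr //= addrA -big_split /=; congr (_ + _).
apply: eq_big_nat => k /andP[_ kn].
by rewrite [RHS]big_nat_recr // ltnW.
Qed.

End Differences.

Section DoubleSequences.
Context {R : realType}.
Implicit Types (a x y : dseq R) (B : matrix4 R).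

(** In two dimensions the difference operator factors into one backward
    difference per index, which reduces the inversion formulas to telescoping
    in each variable. *)
Lemma ddeltaE x m n :
  ddelta x m n = backward_diff (fun i => backward_diff (x i) n) m.
Proof.
by case: m n => [|m] [|n]; rewrite /ddelta /backward_diff ?subr0 ?addr0 // opprB;
   rewrite addrA [RHS]addrAC.
Qed.

Lemma ddeltaK : cancel (@ddelta R) (@dpartial_sum R).
Proof.
move=> x; apply/funext => m; apply/funext => n.
rewrite /dpartial_sum exchange_big /=.
under eq_bigr do (under eq_bigr do rewrite ddeltaE; rewrite sum_backward_diff).
exact: sum_backward_diff.
Qed.

Lemma dpartial_sumK : cancel (@dpartial_sum R) (@ddelta R).
Proof.
move=> y; apply/funext => m; apply/funext => n; rewrite ddeltaE.
have -> : (fun i => backward_diff (dpartial_sum y i) n) =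
          (fun i => \sum_(0 <= k < i.+1) y k n).
  apply/funext => i.
  rewrite -(backward_diff_sum (fun j => \sum_(0 <= k < i.+1) y k j)).
  congr (backward_diff _ n); apply/funext => j.
  exact: exchange_big.
exact: backward_diff_sum.
Qed.

(** Each product [a i j * y k l] with [k <= i <= m] and [l <= j <= n] occurs
    once on both sides; the two triangular exchanges group the terms by
    [(k, l)], and the entry of [dual_matrix a] collects the coefficients. *)
Lemma abel_dpartial_sum a y m n :
  dpartial_sum (fun i j => a i j * dpartial_sum y i j) m n =
  dpartial_sum (fun k l => dual_matrix a m n k l * y k l) m n.
Proof.
transitivity (\sum_(0 <= i < m.+1) \sum_(0 <= k < i.+1)
  \sum_(0 <= j < n.+1) \sum_(0 <= l < j.+1) a i j * y k l).
  apply: eq_bigr => i _; rewrite [RHS]exchange_big /=.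
  apply: eq_bigr => j _; rewrite mulr_sumr.
  by apply: eq_bigr => k _; rewrite mulr_sumr.
rewrite exchange_triangular_sum; apply: eq_big_nat => k /andP[_ km].
under eq_bigr do rewrite exchange_triangular_sum.
rewrite exchange_big /=; apply: eq_big_nat => l /andP[_ ln].
rewrite /dual_matrix -ltnS km -ltnS ln /= mulr_suml.
by apply: eq_bigr => i _; rewrite mulr_suml.
Qed.

(** The summand vanishes outside the rectangle [k <= m], [l <= n], so the
    partial sums are constant once they contain that rectangle. *)
Lemma dual_matrix_cvg a y m n :
  pringsheim (dpartial_sum (fun k l => dual_matrix a m n k l * y k l)) -->
  dpartial_sum (fun k l => dual_matrix a m n k l * y k l) m n.
Proof.
set c := fun k l => _.
have c0 k l : ~~ ((k <= m) && (l <= n))%N -> c k l = 0.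
  by rewrite /c /dual_matrix => /negbTE ->; rewrite mul0r.
apply/pringsheimP => e e0; exists (maxn m n) => M N.
rewrite !gtn_max => /andP[mM _] /andP[_ nN].
suff -> : dpartial_sum c M N = dpartial_sum c m n by rewrite subrr normr0.
rewrite /dpartial_sum (@big_cat_nat _ _ _ m.+1) //=; last exact: ltnW.
rewrite [X in _ + X]big1_seq ?addr0; last first.
  move=> k /andP[_]; rewrite mem_index_iota => /andP[mk _].
  by apply: big1 => l _; apply: c0; rewrite leqNgt mk.
apply: eq_bigr => k _; rewrite (@big_cat_nat _ _ _ n.+1) //=; last exact: ltnW.
rewrite [X in _ + X]big1_seq ?addr0 // => l /andP[_].
by rewrite mem_index_iota => /andP[nl _]; apply: c0; rewrite (leqNgt l) nl andbF.
Qed.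

Lemma dual_matrix_transform_exists a y : transform_exists (dual_matrix a) y.
Proof. by move=> m n; eexists; exact: dual_matrix_cvg. Qed.

Lemma transform_dual_matrix a y :
  transform (dual_matrix a) y =
  dpartial_sum (fun i j => a i j * dpartial_sum y i j).
Proof.
apply/funext => m; apply/funext => n; rewrite abel_dpartial_sum.
by apply: cvg_lim; [exact: Rhausdorff | exact: dual_matrix_cvg].
Qed.

End DoubleSequences.

Local Close Scope ring_scope.

Theorem theorem3p6 (R : realType) (eta theta : conv_mode) :
  beta_dual theta (delta_domain (conv_space R eta)) =
  [set a : dseq R |
     matrix_class (conv_space R eta) (conv_space R theta) (dual_matrix a)].
Proof.
apply/seteqP; split=> a /= Ha.
  move=> y Ly; split; first exact: dual_matrix_transform_exists.
  rewrite transform_dual_matrix; apply: Ha.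
  by rewrite /delta_domain /= dpartial_sumK.
move=> x Lx; have [_] := Ha _ Lx.
by rewrite transform_dual_matrix ddeltaK.
Qed.
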